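(* Let $n_u,n_y$ be positive integers, and let $K^{\mathrm{bin}}\in\mathbb{B}^{n_u\times n_y}$ and $G^{\mathrm{bin}}\in\mathbb{B}^{n_y\times n_u}$ be binary matrices. Define the sequence $(Z_m)_{m\in\mathbb{N}}$ in $\mathbb{B}^{n_u\times n_y}$ by $Z_0=K^{\mathrm{bin}}$ and $Z_{m+1}=Z_m+Z_mG^{\mathrm{bin}}Z_m$ for $m\ge 0$ (all operations in the binary algebra). Then the problem $$\text{minimize } \mathcal{N}(Z)\ \text{ over } Z\in\mathbb{B}^{n_u\times n_y}\ \text{ subject to } ZG^{\mathrm{bin}}Z\le Z,\quad K^{\mathrm{bin}}\le Z$$ has a unique optimal solution $Z^*$, and it satisfies $$Z_{m^*}=Z^*,$$ where $m^*=\lceil\log_2 n\rceil$ and $n=\min\{n_u,n_y\}$.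
   Context: $\mathbb{B}=\{0,1\}$ with the binary (Boolean) algebra: for $x,y\in\mathbb{B}$, $x+y=0$ if $x=y=0$ and $x+y=1$ otherwise; $xy=1$ if $x=y=1$ and $xy=0$ otherwise. Sums and products of binary matrices are formed with these operations, so $(XY)_{ij}=\sum_k X_{ik}Y_{kj}$ with Boolean sum and product. For binary matrices $X,Y$ of the same size, $X\le Y$ means $X_{ij}\le Y_{ij}$ for all $i,j$. For a binary matrix $X$, $\mathcal{N}(X)=\sum_{i,j}X_{ij}$ with the sum taken in the usual (integer) sense, i.e. the number of nonzero entries of $X$. $\mathbb{N}$ includes $0$. *)

(* Defs.v *)
From HB Require Import structures.
From mathcomp Require Import all_boot all_order all_algebra.

Set Implicit Arguments.
Unset Strict Implicit.
Unset Printing Implicit Defensive.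

Import GRing.Theory.
Local Open Scope ring_scope.

(* The two-element Boolean semiring, with 1 + 1 = 1.  An alias of bool is
   needed because the canonical ring structure on bool is that of F_2, whose
   addition is exclusive or. *)
Definition binary : Type := bool.

HB.instance Definition _ := Finite.copy binary bool.

HB.instance Definition _ := GRing.isNzSemiRing.Build binary
  orbA orbC orFb andbA andTb andbT andb_orl andb_orr andFb andbF isT.

HB.instance Definition _ :=
  GRing.PzSemiRing_hasCommutativeMul.Build binary andbC.

Definition binle (p q : nat) (X Y : 'M[binary]_(p, q)) : Prop :=
  forall i j, (nat_of_bool (X i j) <= nat_of_bool (Y i j))%N.

Definition nnz (p q : nat) (X : 'M[binary]_(p, q)) : nat :=
  (\sum_(i < p) \sum_(j < q) nat_of_bool (X i j))%N.

Fixpoint Zseq (nu ny : nat) (K : 'M[binary]_(nu, ny)) (G : 'M[binary]_(ny, nu))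
    (m : nat) : 'M[binary]_(nu, ny) :=
  if m is m'.+1 then Zseq K G m' + Zseq K G m' *m G *m Zseq K G m' else K.

Definition feasible (nu ny : nat) (K : 'M[binary]_(nu, ny))
    (G : 'M[binary]_(ny, nu)) (Z : 'M[binary]_(nu, ny)) : Prop :=
  binle (Z *m G *m Z) Z /\ binle K Z.

Definition optimal (nu ny : nat) (K : 'M[binary]_(nu, ny))
    (G : 'M[binary]_(ny, nu)) (Z : 'M[binary]_(nu, ny)) : Prop :=
  feasible K G Z /\ forall Y, feasible K G Y -> (nnz Z <= nnz Y)%N.

(* Main.v *)
Require Import Defs.
From mathcomp Require Import all_boot all_order all_algebra.

(** Read a binary matrix as a relation between its row and column indices;
    products are then composites of relations and sums are unions.  Put
    [walk_mx K G k] = (K G)^k K.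

    - Every Z with K <= Z and Z G Z <= Z dominates all the Z_m, by induction
      on m, since Z |-> Z + Z G Z is monotone ([Zseq_le_feasible]).  So as
      soon as some Z_m is feasible it is the least feasible matrix, and a
      least feasible matrix is the only minimizer of the number of nonzero
      entries ([binle_nnz_eq]).

    - Z_m is the union of the matrices (K G)^k K for k < 2^m, because each
      step of the recursion doubles the range of exponents: it contains all of
      these ([walk_mx_Zseq]) and nothing but such matrices ([Zseq_walk_mx]).

    - A nonzero entry (i, j) of (K G)^k K is a walk of length k from i in the
      graph of K G, followed by an edge of K into j.  Cutting the cycles out of
      the walk leaves fewer than nu steps.  Since (K G)^k K = K (G K)^k, the
      same argument in the graph of the transpose of G K leaves fewer than ny
      steps.  Hence exponents k < min(nu, ny) already produce all entries
      ([walk_mx_short]).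

    As min(nu, ny) <= 2^m for m = up_log 2 (minn nu ny), Z_m contains every
    (K G)^k K, and therefore also Z_m G Z_m, each of whose entries lies in some
    (K G)^(s+t+1) K. *)

Set Implicit Arguments.
Unset Strict Implicit.
Unset Printing Implicit Defensive.

Local Open Scope ring_scope.

Lemma mulmx_binP (p q r : nat) (A : 'M[binary]_(p, q)) (B : 'M[binary]_(q, r))
    i j :
  reflect (exists2 k, A i k & B k j) ((A *m B) i j).
Proof.
rewrite mxE; have -> : \sum_k A i k * B k j = [exists k, A i k && B k j].
  exact: (big_orE xpredT (fun k => A i k && B k j)).
by apply: (iffP existsP) => [[k /andP[]]|[k Aik Bkj]]; exists k => //; apply/andP.
Qed.

Lemma addmx_binE (p q : nat) (A B : 'M[binary]_(p, q)) i j :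
  (A + B) i j = (A i j || B i j) :> bool.
Proof. by rewrite mxE. Qed.

Lemma mulmx3_binP (p q r s : nat) (A : 'M[binary]_(p, q))
    (B : 'M[binary]_(q, r)) (C : 'M[binary]_(r, s)) i j :
  reflect (exists k l, [/\ A i k, B k l & C l j]) ((A *m B *m C) i j).
Proof.
apply: (iffP (mulmx_binP _ _ _ _)) => [[l /mulmx_binP[k Aik Bkl] Clj]|].
  by exists k, l.
by move=> [k [l [Aik Bkl Clj]]]; exists l => //; apply/mulmx_binP; exists k.
Qed.

Lemma binleP (p q : nat) (X Y : 'M[binary]_(p, q)) :
  binle X Y <-> forall i j, X i j -> Y i j.
Proof.
split=> XY i j; first by have := XY i j; case: (X i j); case: (Y i j).
by have := XY i j; case: (X i j); case: (Y i j) => //= /(_ isT).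
Qed.

Lemma binle_nnz (p q : nat) (X Y : 'M[binary]_(p, q)) :
  binle X Y -> (nnz X <= nnz Y)%N.
Proof. by move=> XY; do 2![apply: leq_sum => ? _]; apply: XY. Qed.

Lemma binle_nnz_eq (p q : nat) (X Y : 'M[binary]_(p, q)) :
  binle X Y -> (nnz Y <= nnz X)%N -> X = Y.
Proof.
move=> XY leYX; apply/matrixP => i j.
(* Termwise inequality with equal sums forces termwise equality, for the sum
   over rows and then within each row. *)
have eqXY : nnz X == nnz Y by rewrite eqn_leq binle_nnz.
have leif_row k : (\sum_(l < q) nat_of_bool (X k l)
    <= \sum_(l < q) nat_of_bool (Y k l)
    ?= iff [forall l, nat_of_bool (X k l) == nat_of_bool (Y k l)])%N.
  by apply: leqif_sum => l _; apply: leqif_eq; apply: XY.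
have := leqif_sum (fun k (_ : xpredT k) => leif_row k).
case=> _; rewrite -/(nnz X) -/(nnz Y) eqXY => /esym/forallP/(_ i)/forallP/(_ j).
by case: (X i j); case: (Y i j).
Qed.

Fixpoint walk_mx (p q : nat) (K : 'M[binary]_(p, q)) (G : 'M[binary]_(q, p))
    (k : nat) : 'M[binary]_(p, q) :=
  if k is k'.+1 then K *m G *m walk_mx K G k' else K.

Section Walks.

Variables (p q : nat) (K : 'M[binary]_(p, q)) (G : 'M[binary]_(q, p)).

Lemma walk_mxD s t :
  walk_mx K G (s + t).+1 = walk_mx K G s *m G *m walk_mx K G t.
Proof. by elim: s => //= s ->; rewrite !mulmxA. Qed.

(** Paths of the library are used here so that [shortenP] can remove loops. *)
Lemma walk_mxP k i j :
  reflect (exists w, [/\ path (fun x y => (K *m G) x y) i w, size w = k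
                       & K (last i w) j])
          (walk_mx K G k i j).
Proof.
apply: (iffP idP) => [|[w [ew <-]]].
  elim: k i => [|k IH] i /=; first by exists [::].
  move=> /mulmx_binP[l il /IH[w [ew sw Kj]]].
  by exists (l :: w); split=> //=; [rewrite il|rewrite sw].
elim: w i ew => //= l w IH i /andP[il ew] Kj.
by apply/mulmx_binP; exists l => //; apply: IH.
Qed.

Lemma walk_mx_short_row k i j :
  walk_mx K G k i j -> exists2 k', (k' < p)%N & walk_mx K G k' i j.
Proof.
move=> /walk_mxP[w [ew _]]; case/shortenP: ew => w' ew' uw' _ Kj.
exists (size w'); last by apply/walk_mxP; exists w'.
by have := max_card (mem (i :: w')); rewrite (card_uniqP uw') card_ord.
Qed.

End Walks.

(** This is (K G)^k K = K (G K)^k, transposed; it turns the bound by the number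
    of rows in [walk_mx_short_row] into one by the number of columns. *)
Lemma trmx_walk_mx (p q : nat) (K : 'M[binary]_(p, q)) (G : 'M[binary]_(q, p))
    k :
  (walk_mx K G k)^T = walk_mx K^T G^T k.
Proof.
elim: k => //= k <-.
by rewrite -[K *m G *m _](walk_mxD K G 0) add0n -[k in LHS]addn0 walk_mxD /=
  !trmx_mul mulmxA.
Qed.

Lemma walk_mx_short (p q : nat) (K : 'M[binary]_(p, q))
    (G : 'M[binary]_(q, p)) k i j :
  walk_mx K G k i j -> exists2 k', (k' < minn p q)%N & walk_mx K G k' i j.
Proof.
move=> Wk; case: (leqP p q) => _; first exact: walk_mx_short_row Wk.
have tr k0 : walk_mx K G k0 i j = walk_mx K^T G^T k0 j i.
  by rewrite -trmx_walk_mx mxE.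
rewrite tr in Wk; have [k' ltk' Wk'] := walk_mx_short_row Wk.
by exists k'; rewrite ?tr.
Qed.

Section Iteration.

Variables (p q : nat) (K : 'M[binary]_(p, q)) (G : 'M[binary]_(q, p)).

Lemma Zseq_walk_mx m i j : Zseq K G m i j -> exists k, walk_mx K G k i j.
Proof.
elim: m i j => [|m IH] i j /=; first by exists 0.
rewrite addmx_binE => /orP[/IH //|].
move=> /mulmx3_binP[l [r [/IH[s Ws] Glr /IH[t Wt]]]].
by exists (s + t).+1; rewrite walk_mxD; apply/mulmx3_binP; exists l, r.
Qed.

Lemma walk_mx_Zseq m k i j :
  (k < 2 ^ m)%N -> walk_mx K G k i j -> Zseq K G m i j.
Proof.
elim: m k i j => [|m IH] k i j /=; first by case: k.
rewrite addmx_binE => ltk Wk.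
case: (ltnP k (2 ^ m)) => [ltkm|lemk]; first by rewrite (IH k).
have pow_gt0 : (0 < 2 ^ m)%N by rewrite expn_gt0.
(* The walk splits at a step of G into parts of lengths 2^m - 1 and k - 2^m,
   both below 2^m. *)
have defk : k = ((2 ^ m).-1 + (k - 2 ^ m)).+1 by rewrite -addSn prednK ?subnKC.
move: Wk; rewrite defk walk_mxD => /mulmx3_binP[l [r [Ws Glr Wt]]].
apply/orP; right; apply/mulmx3_binP; exists l, r; split=> //.
  by apply: IH Ws; rewrite prednK.
by apply: IH Wt; rewrite ltn_subLR // addnn -mul2n -expnS.
Qed.

Lemma Zseq_le_feasible m Y : feasible K G Y -> binle (Zseq K G m) Y.
Proof.
move=> [/binleP YGY /binleP KY]; apply/binleP.
elim: m => [|m IH] i j /=; first exact: KY.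
rewrite addmx_binE => /orP[/IH //|/mulmx3_binP[l [r [Zil Glr Zrj]]]].
by apply/YGY/mulmx3_binP; exists l, r; split=> //; apply: IH.
Qed.

Lemma Zseq_feasible m : (minn p q <= 2 ^ m)%N -> feasible K G (Zseq K G m).
Proof.
move=> le_n; have walkZ k i j : walk_mx K G k i j -> Zseq K G m i j.
  move=> /walk_mx_short[k' ltk']; apply: walk_mx_Zseq.
  exact: leq_trans ltk' le_n.
split; apply/binleP => i j; last exact: (walkZ 0).
(* An entry of Z_m G Z_m is an entry of Z_(m+1). *)
move=> ZGZ; have /Zseq_walk_mx[k /walkZ //] : Zseq K G m.+1 i j.
by rewrite /= addmx_binE ZGZ orbT.
Qed.

End Iteration.

Theorem theorem6 (nu ny : nat) (hnu : (0 < nu)%N) (hny : (0 < ny)%N)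
    (K : 'M[binary]_(nu, ny)) (G : 'M[binary]_(ny, nu)) :
  exists Zstar : 'M[binary]_(nu, ny),
    [/\ optimal K G Zstar,
        forall Z : 'M[binary]_(nu, ny), optimal K G Z -> Z = Zstar
      & Zseq K G (up_log 2 (minn nu ny)) = Zstar].
Proof.
have feasZ : feasible K G (Zseq K G (up_log 2 (minn nu ny))).
  by apply: Zseq_feasible; apply: up_logP.
exists (Zseq K G (up_log 2 (minn nu ny))); split=> //.
  by split=> // Y feasY; apply/binle_nnz/Zseq_le_feasible.
move=> Z [feasY minZ]; apply/esym/binle_nnz_eq; last exact: minZ.
exact: Zseq_le_feasible.
Qed.
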